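(* Let $G$ be a graph with $n$ vertices. Then $\operatorname{depth}_E W(G,1)=n-\alpha(G)$, where $\alpha(G)$ is the independence number of $G$.
   Context: Let $\mathbf{k}$ be an algebraically closed field of characteristic zero. Graphs are finite and simple. $W(G,1)$ denotes the graph formed by attaching one new degree-one vertex to each vertex of $G$. A set of vertices of $G$ is independent if no two of its vertices are adjacent; $\alpha(G)$ is the largest number of vertices in any independent set of $G$. For a graph $H$ with vertices $v_1,\dots,v_N$, let $E=\bigwedge_{\mathbf k}\langle e_1,\dots,e_N\rangle$ be the exterior algebra over $\mathbf{k}$ in $N$ variables, with degree-one part $E_1$, and let $I_E(H)=(e_ie_j \mid \{v_i,v_j\}\text{ is an edge of }H)\subseteq E$. For a graded $E$-module $M$, an element $\ell\in E_1$ is $M$-regular if $\{y\in M\mid \ell y=0\}=\ell M$. A sequence $\ell_1,\dots,\ell_r\in E_1$ is an $M$-regular sequence if $\ell_i$ is regular on $M/(\ell_1,\dots,\ell_{i-1})M$ for all $i\le r$; $\operatorname{depth}_E M$ is the maximum length of an $M$-regular sequence. Write $\operatorname{depth}_E H=\operatorname{depth}_E E/I_E(H)$, where $E$ is the exterior algebra on the vertices of $H$. The empty graph has depth $0$. *)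

(* Defs.v *)
From HB Require Import structures.
From mathcomp Require Import all_boot all_algebra ring.
From mathcomp Require Import boolp.

Set Implicit Arguments.
Unset Strict Implicit.
Unset Printing Implicit Defensive.

Import GRing.Theory.
Local Open Scope ring_scope.

(* A record rather than an alias: {ffun _ -> _} already carries the pointwise
   product.  [coef x A] is the coefficient of e_{a_1} ... e_{a_r}, where
   A = {a_1, ..., a_r} is listed increasingly for [enum_rank]. *)
Record ext (k : fieldType) (I : finType) := Ext { coef : {ffun {set I} -> k} }.

HB.instance Definition _ (k : fieldType) (I : finType) :=
  [isNew for @coef k I].
HB.instance Definition _ (k : fieldType) (I : finType) :=
  [Choice of ext k I by <:].

Section Exterior.
Variables (k : fieldType) (I : finType).
Local Notation E := (ext k I).
Implicit Types (x y z : E) (A B C S : {set I}) (c : k).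

Lemma extP x y : (forall A, coef x A = coef y A) -> x = y.
Proof. by case: x y => f [g] /= fg; congr Ext; apply/ffunP. Qed.

Definition ext_zero : E := Ext 0.
Definition ext_opp x : E := Ext (- coef x).
Definition ext_add x y : E := Ext (coef x + coef y).

Lemma ext_addA : associative ext_add.
Proof. by move=> x y z; rewrite /ext_add /= addrA. Qed.
Lemma ext_addC : commutative ext_add.
Proof. by move=> x y; rewrite /ext_add addrC. Qed.
Lemma ext_add0 : left_id ext_zero ext_add.
Proof. by case=> f; rewrite /ext_add /= add0r. Qed.
Lemma ext_addN : left_inverse ext_zero ext_opp ext_add.
Proof. by move=> x; rewrite /ext_add /= addNr. Qed.

HB.instance Definition _ :=
  GRing.isZmodule.Build E ext_addA ext_addC ext_add0 ext_addN.

Definition ext_scale c x : E := Ext [ffun A => c * coef x A].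

Lemma ext_scaleA a b x : ext_scale a (ext_scale b x) = ext_scale (a * b) x.
Proof. by apply: extP => A; rewrite /= !ffunE mulrA. Qed.
Lemma ext_scale1 : left_id 1 ext_scale.
Proof. by move=> x; apply: extP => A; rewrite /= ffunE mul1r. Qed.
Lemma ext_scaleDr : right_distributive ext_scale +%R.
Proof. by move=> c x y; apply: extP => A; rewrite /= !ffunE mulrDr. Qed.
Lemma ext_scaleDl x : {morph ext_scale^~ x : a b / a + b}.
Proof. by move=> a b; apply: extP => A; rewrite /= !ffunE mulrDl. Qed.

HB.instance Definition _ := GRing.Zmodule_isLmodule.Build k E
  ext_scaleA ext_scale1 ext_scaleDr ext_scaleDl.

Lemma coefD x y A : coef (x + y) A = coef x A + coef y A.
Proof. by rewrite /= ffunE. Qed.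
Lemma coefZ c x A : coef (c *: x) A = c * coef x A.
Proof. by rewrite /= ffunE. Qed.

(* For disjoint A and B, e_A e_B = (-1) ^+ inversions A B * e_(A :|: B). *)
Definition inversions A B : nat :=
  \sum_(a in A) \sum_(b in B) (enum_rank b < enum_rank a).

Definition ext_mul x y : E := Ext [ffun S : {set I} =>
  \sum_(A : {set I} | A \subset S)
     (-1) ^+ inversions A (S :\: A) * coef x A * coef y (S :\: A)].

Definition ext_one : E := Ext [ffun A : {set I} => (A == set0)%:R].

Lemma inversionsUl A B C : [disjoint A & B] ->
  inversions (A :|: B) C = (inversions A C + inversions B C)%N.
Proof.
move=> dAB; rewrite /inversions -bigU //.
by apply: eq_bigl => i; rewrite !inE.
Qed.

Lemma inversionsUr A B C : [disjoint B & C] ->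
  inversions A (B :|: C) = (inversions A B + inversions A C)%N.
Proof.
move=> dBC; rewrite /inversions -big_split /=; apply: eq_bigr => a _.
by rewrite -bigU //; apply: eq_bigl => i; rewrite !inE.
Qed.

Lemma inversions0l A : inversions set0 A = 0%N.
Proof. by rewrite /inversions big_set0. Qed.

Lemma inversions0r A : inversions A set0 = 0%N.
Proof. by rewrite /inversions big1 // => a _; rewrite big_set0. Qed.

Lemma ext_mulA : associative ext_mul.
Proof.
move=> x y z; apply: extP => S; rewrite /= !ffunE; symmetry.
under eq_bigr => D _ do rewrite ffunE mulr_sumr mulr_suml.
rewrite (exchange_big_dep (fun A : {set I} => A \subset S)) /=; last first.
  by move=> D A DS AD; exact: subset_trans AD DS.
apply: eq_bigr => A AS; rewrite ffunE mulr_sumr.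
rewrite (reindex_onto (fun B => A :|: B) (fun D => D :\: A)) /=; last first.
  move=> D /andP[DS AD]; apply/setP => i; rewrite !inE.
  by case: (boolP (i \in A)) => //= /(subsetP AD) ->.
have disj B : (B \subset S :\: A) = (B \subset S) && [disjoint A & B].
  by rewrite subsetD disjoint_sym.
have subAB B : (A :|: B) :\: A == B = [disjoint A & B].
  rewrite -setI_eq0; apply/eqP/eqP => h; apply/setP => i;
    by move/setP: h => /(_ i); rewrite !inE; do 2!case: (_ \in _).
apply: eq_big => [B | B].
  by rewrite subsetUl andbT subUset AS /= disj subAB.
rewrite subsetUl andbT subUset AS /= subAB => /andP[BS dAB].
have /eqP -> : (A :|: B) :\: A == B by rewrite subAB.
set C := S :\: A :\: B.
have -> : S :\: (A :|: B) = C.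
  by apply/setP => i; rewrite !inE negb_or -andbA andbCA.
have -> : S :\: A = B :|: C.
  have /subsetP BSA : B \subset S :\: A by rewrite disj BS.
  apply/setP => i; move: (BSA i); rewrite !inE.
  by case: (i \in B) => //= ->.
have dBC : [disjoint B & C].
  by rewrite -setI_eq0; apply/eqP/setP => i; rewrite !inE; case: (i \in B).
rewrite inversionsUl // inversionsUr // !exprD; ring.
Qed.

Lemma ext_mul1l : left_id ext_one ext_mul.
Proof.
move=> x; apply: extP => S; rewrite /= ffunE (bigD1 set0) ?sub0set //=.
rewrite big1 ?addr0 => [|A /andP[_ /negPf A0]]; last first.
  by rewrite ffunE A0 mulr0 mul0r.
by rewrite ffunE eqxx inversions0l setD0 !mul1r.
Qed.

Lemma ext_mul1r : right_id ext_one ext_mul.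
Proof.
move=> x; apply: extP => S; rewrite /= ffunE (bigD1 S) //=.
rewrite big1 ?addr0 => [|A /andP[AS nAS]]; last first.
  rewrite ffunE setD_eq0; case: eqP nAS => // nAS _; rewrite ?mulr0 //.
  case: (boolP (S \subset A)) => SA; rewrite ?mulr0 //.
  by case: nAS; apply/eqP; rewrite eqEsubset AS.
by rewrite setDv inversions0r ffunE eqxx mul1r mulr1.
Qed.

Lemma ext_mulDl : left_distributive ext_mul +%R.
Proof.
move=> x y z; apply: extP => S; rewrite /= !ffunE -big_split.
by apply: eq_bigr => A _; rewrite !ffunE /=; ring.
Qed.

Lemma ext_mulDr : right_distributive ext_mul +%R.
Proof.
move=> x y z; apply: extP => S; rewrite /= !ffunE -big_split.
by apply: eq_bigr => A _; rewrite !ffunE /=; ring.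
Qed.

Lemma ext_one_neq0 : ext_one != 0.
Proof.
apply/eqP => /(congr1 (fun x => coef x set0)).
by rewrite /= !ffunE eqxx => /eqP; rewrite oner_eq0.
Qed.

HB.instance Definition _ := GRing.Zmodule_isNzRing.Build E
  ext_mulA ext_mul1l ext_mul1r ext_mulDl ext_mulDr ext_one_neq0.

Lemma coefM x y S : coef (x * y) S = \sum_(A : {set I} | A \subset S)
  (-1) ^+ inversions A (S :\: A) * coef x A * coef y (S :\: A).
Proof. by rewrite /= ffunE. Qed.

Lemma ext_scaleAl c x y : c *: (x * y) = (c *: x) * y.
Proof.
apply: extP => S; rewrite coefZ !coefM mulr_sumr.
by apply: eq_bigr => A _; rewrite coefZ; ring.
Qed.

HB.instance Definition _ := GRing.Lmodule_isLalgebra.Build k E ext_scaleAl.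

Lemma ext_scaleAr c x y : c *: (x * y) = x * (c *: y).
Proof.
apply: extP => S; rewrite coefZ !coefM mulr_sumr.
by apply: eq_bigr => A _; rewrite coefZ; ring.
Qed.

HB.instance Definition _ := GRing.Lalgebra_isAlgebra.Build k E ext_scaleAr.

Definition gen (i : I) : E := Ext [ffun A : {set I} => (A == [set i])%:R].

Definition deg1 x : Prop := exists c : I -> k, x = \sum_i c i *: gen i.

Lemma coef_gen2 i j S : coef (gen i * gen j) S =
  (-1) ^+ (enum_rank j < enum_rank i)%N * ((i != j) && (S == [set i; j]))%:R.
Proof.
rewrite coefM (bigID (pred1 [set i])) /= addrC big1 ?add0r => [|A /andP[_ /negPf nA]].
  2: by rewrite ffunE nA mulr0 mul0r.
have [iS|iS] := boolP ([set i] \subset S); last first.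
  rewrite big_pred0 => [|A]; last by case: eqP => [->|]; rewrite ?andbF // (negPf iS).
  case: (S =P _) iS => [->|_ _]; rewrite ?andbF ?mulr0 //.
  by rewrite sub1set !inE eqxx.
rewrite (big_pred1 [set i]) => [|A]; last by rewrite /=; case: (A =P _) => [->|_]; rewrite ?andbF ?iS ?eqxx.
rewrite !ffunE eqxx mulr1.
have -> : (S :\ i == [set j]) = (i != j) && (S == [set i; j]).
  apply/eqP/andP => [h|[ij /eqP ->]].
    have : j \in S :\ i by rewrite h set11.
    rewrite !inE eq_sym => /andP[ij jS]; split=> //.
    by rewrite -h setD1K // -sub1set.
  apply/setP => a; rewrite !inE; case: (a =P i) => //= ->.
  by rewrite (negPf ij).
case: andP => [[ij /eqP ->]|]; rewrite ?mulr0 // /inversions big_set1.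
have -> : [set i; j] :\ i = [set j].
  apply/setP => a; rewrite !inE; case: (a =P i) => //= ->.
  by rewrite (negPf ij).
by rewrite big_set1.
Qed.

Lemma gen_sqr i : gen i * gen i = 0.
Proof.
by apply: extP => S; rewrite coef_gen2 eqxx mulr0 /= ffunE.
Qed.

Lemma gen_anticomm i j : gen i * gen j = - (gen j * gen i).
Proof.
apply: extP => S; rewrite coef_gen2 [RHS]ffunE coef_gen2 setUC (eq_sym j).
case: (eqVneq i j) => [->|ij]; rewrite ?mulr0 ?oppr0 //= -mulNr.
have : enum_rank i != enum_rank j by rewrite (inj_eq enum_rank_inj).
by rewrite -val_eqE /=; case: ltngtP => //= _ _; rewrite ?expr0 ?expr1 ?opprK.
Qed.

End Exterior.

Section Modules.
Variable R : nzRingType.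
Implicit Types (M : lmodType R).

Definition submod_gen M (X : M -> Prop) : {pred M} := fun y =>
  `[< exists s : seq (R * M), (forall p, p \in s -> X p.2)
        /\ y = \sum_(p <- s) p.1 *: p.2 >].

Lemma submod_gen_closed M (X : M -> Prop) : submod_closed (submod_gen X).
Proof.
split=> [|a u v /asboolP[s [sX ->]] /asboolP[t [tX ->]]]; apply/asboolP.
  by exists [::]; rewrite big_nil.
exists ([seq (a * p.1, p.2) | p <- s] ++ t); split=> [p|].
  by rewrite mem_cat => /orP[/mapP[q /sX qX ->]|/tX].
rewrite big_cat big_map scaler_sumr; congr (_ + _).
by apply: eq_bigr => p _; rewrite scalerA.
Qed.

HB.instance Definition _ M (X : M -> Prop) :=
  GRing.isSubmodClosed.Build R M (submod_gen X) (submod_gen_closed X).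

Section Quotient.
Variables (M : lmodType R) (N : submodClosed M).
Local Open Scope quotient_scope.

(* [submodClosed] does not coerce to the [zmodClosed] that [Quotient.quot]
   expects. *)
Definition zmod_of_submod : {pred M} := N.
HB.instance Definition _ := GRing.isZmodClosed.Build M zmod_of_submod
  (GRing.submod_closedB (submodClosedP N)).

Definition qmod := Quotient.quot zmod_of_submod.
HB.instance Definition _ := GRing.Zmodule.on qmod.
HB.instance Definition _ := Quotient.on qmod.

Definition qmod_scale (a : R) (u : qmod) : qmod := \pi_qmod (a *: repr u).

Lemma qmodD (x y : M) : \pi_qmod (x + y) = \pi_qmod x + \pi_qmod y.
Proof. exact: (raddfD \pi_(Quotient.quot zmod_of_submod)). Qed.

Lemma qmod_eq (x y : M) : (\pi_qmod x == \pi_qmod y) = (x - y \in N).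
Proof. exact: (esym (Quotient.idealrBE zmod_of_submod x y)). Qed.

Lemma qmod_scaleE a (x : M) : qmod_scale a (\pi_qmod x) = \pi_qmod (a *: x).
Proof.
by apply/eqP; rewrite qmod_eq -scalerBr rpredZ // -qmod_eq reprK.
Qed.

Lemma qmod_scaleA a b u : qmod_scale a (qmod_scale b u) = qmod_scale (a * b) u.
Proof. by rewrite -[u]reprK (qmod_scaleE b) !qmod_scaleE scalerA. Qed.
Lemma qmod_scale1 : left_id 1 qmod_scale.
Proof. by move=> u; rewrite -[u]reprK qmod_scaleE scale1r. Qed.
Lemma qmod_scaleDr : right_distributive qmod_scale +%R.
Proof.
move=> a u v; rewrite -[u]reprK -[v]reprK.
by rewrite -qmodD !qmod_scaleE scalerDr qmodD.
Qed.
Lemma qmod_scaleDl u : {morph qmod_scale^~ u : a b / a + b}.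
Proof. by move=> a b; rewrite -[u]reprK !qmod_scaleE scalerDl qmodD. Qed.

HB.instance Definition _ := GRing.Zmodule_isLmodule.Build R qmod
  qmod_scaleA qmod_scale1 qmod_scaleDr qmod_scaleDl.

End Quotient.

(* The left submodule of R generated by X * R, i.e. the two-sided ideal (X). *)
Definition ideal_gen (X : R -> Prop) : {pred R^o} :=
  submod_gen (fun y : R^o => exists2 x, X x & exists b, y = x * b).
HB.instance Definition _ (X : R -> Prop) :=
  GRing.SubmodClosed.on (ideal_gen X).

Definition ideal_mul (J : {pred R^o}) M : {pred M} := submod_gen
  (fun y : M => exists2 x : R, x \in J & exists m : M, y = x *: m).
Arguments ideal_mul J M : clear implicits.
HB.instance Definition _ (J : {pred R^o}) M :=
  GRing.SubmodClosed.on (ideal_mul J M).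

Definition reg_elt M (l : R) : Prop :=
  forall y : M, l *: y = 0 <-> exists z : M, y = l *: z.

End Modules.
Arguments ideal_mul {R} J M.
Arguments reg_elt {R} M l.

Section Depth.
Variables (k : fieldType) (I : finType).
Local Notation E := (ext k I).
Implicit Type M : lmodType E.

Definition reg_seq M (s : seq E) : Prop :=
  forall i, (i < size s)%N -> deg1 s`_i /\
    reg_elt (qmod (ideal_mul (ideal_gen (fun x => x \in take i s)) M)) s`_i.

(* [d] is the maximum length of an M-regular sequence; the grading of M plays
   no role in this notion. *)
Definition is_depth M (d : nat) : Prop :=
  (exists2 s, reg_seq M s & size s = d) /\
  (forall s, reg_seq M s -> (size s <= d)%N).

End Depth.
Arguments reg_seq {k I} M s.
Arguments is_depth {k I} M d.

Record sgraph := SGraph {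
  vertex :> finType;
  edge : rel vertex;
  edge_sym : symmetric edge;
  edge_irrefl : irreflexive edge
}.

Definition independent (G : sgraph) (A : {set G}) : bool :=
  [forall u in A, forall v in A, ~~ edge u v].

Definition indep_num (G : sgraph) : nat :=
  \max_(A : {set G} | independent A) #|A|.

Section Whisker.
Variable G : sgraph.

(* [inl v] is the original vertex v and [inr v] the new leaf attached to it. *)
Definition whisker_edge : rel (G + G)%type := fun a b =>
  match a, b with
  | inl u, inl v => edge u v
  | inl u, inr v | inr u, inl v => u == v
  | inr _, inr _ => false
  end.

Lemma whisker_sym : symmetric whisker_edge.
Proof. by case=> u [] v //=; rewrite edge_sym. Qed.

Lemma whisker_irrefl : irreflexive whisker_edge.
Proof. by case=> u //=; rewrite edge_irrefl. Qed.

Definition whisker : sgraph := SGraph whisker_sym whisker_irrefl.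

End Whisker.

Definition edge_ideal (k : fieldType) (H : sgraph) : {pred (ext k H)^o} :=
  ideal_gen (fun x => exists i j : H, edge i j /\ x = gen k i * gen k j).
Arguments edge_ideal : clear implicits.
HB.instance Definition _ (k : fieldType) (H : sgraph) :=
  GRing.SubmodClosed.on (edge_ideal k H).

Definition graph_depth (k : fieldType) (H : sgraph) (d : nat) : Prop :=
  is_depth (qmod (edge_ideal k H)) d.

(* Main.v *)
From mathcomp Require Import all_boot all_algebra ring.
From mathcomp Require Import boolp.
Require Import Defs.

Set Implicit Arguments.
Unset Strict Implicit.
Unset Printing Implicit Defensive.

Import GRing.Theory.
Local Open Scope ring_scope.

(** Write x_v for the vertex v of G and y_v for its leaf, I for the edge ideal
    of the whisker graph and M = E/I.  The monomials on independent vertex sets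
    form a basis of M.

    Lower bound.  As a module over the exterior algebra on the y_v, M is the
    direct sum, over the independent sets S of G, of the submodules with x-part
    exactly S; each of these is the exterior algebra on the y_v, v not in S, the
    other leaves acting by zero.  Linear forms in the leaves are a regular
    sequence there as soon as they stay linearly independent after the y_v, v in
    S, are set to zero.  At least n - alpha leaves survive, so the moment forms
    sum_v t_v^j y_v, 0 <= j < n - alpha, with distinct t_v, suffice for all S at
    once by Vandermonde.  Regularity is witnessed by a contracting homotopy
    ([contract_deg1M]): contraction against a functional d with d(l_i) = 1 and
    d(l_j) = 0 for j < i, where d depends on S and kills y_v for v in S.  The
    last condition is what makes the homotopy preserve I
    ([moment_seq_regular]).

    Upper bound.  Every nontrivial combination of a regular sequence is itself
    regular on M ([regular_seq_comb]).  Let A be a maximum independent set.  If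
    the sequence were longer than n - alpha, the number of y_w with w outside A,
    some nontrivial combination l would involve none of these y_w.  Then l acts
    on the span M_0 of the independent sets avoiding them, a direct summand of
    M for the action of l, with kernel equal to image, so dim M_0 is even
    ([regular_even]).  But a basis element of M_0 is an independent set S of G
    together with a subset of A \ S, so dim M_0 is the sum of the 2 ^ |A \ S|,
    in which only S = A contributes an odd term ([card_half_whisker_odd]). *)

(** * Signs, linear forms and contractions in the exterior algebra *)

Section ExteriorFacts.
Variables (k : fieldType) (I : finType).
Local Notation E := (ext k I).
Local Notation gen := (gen k).
Implicit Types (f g l : E) (i j : I) (S T : {set I}).

Definition sgn i T : k := (-1) ^+ inversions [set i] T.

Lemma sgn_sqr i T : sgn i T * sgn i T = 1.
Proof. by rewrite /sgn -exprD addnn -mul2n exprM sqrrN expr1n expr1n. Qed.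

Lemma sgnU1 i j T : j \notin T ->
  sgn i (j |: T) = (-1) ^+ (enum_rank j < enum_rank i)%N * sgn i T.
Proof.
move=> jT; rewrite /sgn inversionsUr ?disjoints1 // exprD; congr (_ ^+ _ * _).
by rewrite /inversions !big_set1.
Qed.

Lemma sgn_swap i j T : i != j -> i \notin T -> j \notin T ->
  sgn i (j |: T) * sgn j T = - (sgn j (i |: T) * sgn i T).
Proof.
move=> ij iT jT; rewrite !sgnU1 //.
have : enum_rank i != enum_rank j by rewrite (inj_eq enum_rank_inj).
rewrite -val_eqE /=; case: ltngtP => //= _ _; rewrite ?expr0 ?expr1; ring.
Qed.

Lemma coef_sum (J : Type) (r : seq J) (P : pred J) (F : J -> E) S :
  coef (\sum_(j <- r | P j) F j) S = \sum_(j <- r | P j) coef (F j) S.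
Proof.
apply: (big_morph (fun x : E => coef x S)) => [x y|]; first exact: coefD.
by rewrite /= ffunE.
Qed.

Lemma coefN f S : coef (- f) S = - coef f S.
Proof. by rewrite /= ffunE. Qed.

Lemma coefB f g S : coef (f - g) S = coef f S - coef g S.
Proof. by rewrite coefD coefN. Qed.

Lemma coef_gen i S : coef (gen i) S = (S == [set i])%:R.
Proof. by rewrite /= ffunE. Qed.

Lemma coef_genM i f S : coef (gen i * f) S =
  if i \in S then sgn i (S :\ i) * coef f (S :\ i) else 0.
Proof.
rewrite coefM; case: ifPn => iS; last first.
  rewrite big1 // => A AS; rewrite coef_gen; case: eqP => [Ai|]; last by rewrite mulr0 mul0r.
  by move: AS; rewrite Ai sub1set (negPf iS).
rewrite (bigD1 [set i]) ?sub1set //= coef_gen eqxx mulr1 big1 ?addr0 //.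
by move=> A /andP[_ /negPf Ai]; rewrite coef_gen Ai mulr0 mul0r.
Qed.

Lemma coef_Mgen i f S : coef (f * gen i) S =
  if i \in S then (-1) ^+ inversions (S :\ i) [set i] * coef f (S :\ i) else 0.
Proof.
rewrite coefM; case: ifPn => iS; last first.
  rewrite big1 // => A AS; rewrite coef_gen; case: eqP => [Ai|]; last by rewrite mulr0.
  by case/negP: iS; rewrite -sub1set -Ai subsetDl.
rewrite (bigD1 (S :\ i)) ?subsetDl //= coef_gen.
have -> : S :\: (S :\ i) = [set i].
  by rewrite setDDr setDv set0U; apply/setIidPr; rewrite sub1set.
rewrite eqxx mulr1 big1 ?addr0 //.
move=> A /andP[AS /negPf Ai]; rewrite coef_gen; case: eqP => [e|]; last by rewrite mulr0.
by rewrite -e setDDr setDv set0U (setIidPr AS) eqxx in Ai.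
Qed.

Definition grade_inv f : E := Ext [ffun A : {set I} => (-1) ^+ #|A| * coef f A].

(** Commuting a generator past e_A costs one sign for each element of A, so left
    and right multiples of a linear form agree up to the grade involution. *)
Lemma grade_invM i f : f * gen i = gen i * grade_inv f.
Proof.
apply: extP => S; rewrite coef_Mgen coef_genM; case: ifP => // iS.
rewrite /= ffunE mulrA /sgn -exprD; congr (_ * _).
rewrite -[LHS]signr_odd -[RHS]signr_odd; congr ((-1) ^+ nat_of_bool _).
rewrite oddD /inversions big_set1.
under eq_bigr do rewrite big_set1.
have -> : #|S :\ i| = (\sum_(a in S :\ i) (enum_rank i < enum_rank a) +
  \sum_(a in S :\ i) (enum_rank a < enum_rank i))%N.
  rewrite -big_split -sum1_card /=; apply: eq_bigr => a; rewrite !inE => /andP[ai _].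
  have : enum_rank i != enum_rank a by rewrite (inj_eq enum_rank_inj) eq_sym.
  by rewrite -val_eqE /=; case: ltngtP.
by rewrite oddD [RHS]addbC addbK.
Qed.

Lemma deg1_gen i : deg1 (gen i).
Proof.
exists (fun j => (j == i)%:R); rewrite (bigD1 i) //= eqxx scale1r big1 ?addr0 //.
by move=> j /negPf ->; rewrite scale0r.
Qed.

Lemma deg1D l l' : deg1 l -> deg1 l' -> deg1 (l + l').
Proof.
move=> [c ->] [c' ->]; exists (fun i => c i + c' i).
by rewrite -big_split; apply: eq_bigr => i _; rewrite scalerDl.
Qed.

Lemma deg1Z (a : k) l : deg1 l -> deg1 (a *: l).
Proof.
move=> [c ->]; exists (fun i => a * c i).
by rewrite scaler_sumr; apply: eq_bigr => i _; rewrite scalerA.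
Qed.

Lemma deg1_0 : deg1 (0 : E).
Proof. by exists (fun=> 0); rewrite big1 // => i _; rewrite scale0r. Qed.

Lemma deg1_sum (J : finType) (F : J -> E) :
  (forall a, deg1 (F a)) -> deg1 (\sum_a F a).
Proof. by move=> dF; apply: big_ind => //; [apply: deg1_0 | apply: deg1D]. Qed.

Lemma deg1_coef l : deg1 l -> l = \sum_i coef l [set i] *: gen i.
Proof.
move=> [c ->]; apply: eq_bigr => i _; congr (_ *: _).
rewrite coef_sum (bigD1 i) // big1 ?addr0.
  by rewrite coefZ coef_gen eqxx mulr1 /= addr0.
move=> j /andP[_ ji]; rewrite coefZ coef_gen (inj_eq set1_inj) eq_sym (negPf ji).
by rewrite mulr0.
Qed.

Lemma deg1_anticomm l l' : deg1 l -> deg1 l' -> l * l' = - (l' * l).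
Proof.
move=> [c ->] [c' ->]; rewrite !mulr_suml -sumrN.
under eq_bigr do rewrite mulr_sumr.
under [RHS]eq_bigr do rewrite mulr_sumr -sumrN.
rewrite exchange_big; apply: eq_bigr => i _; apply: eq_bigr => j _.
rewrite -!scalerAl -!scalerAr !scalerA -scalerN -gen_anticomm.
by rewrite mulrC.
Qed.

(** The induction carries membership in degree one along, since the cross terms
    cancel by anticommutation only there. *)
Lemma deg1_sqr l : deg1 l -> l * l = 0.
Proof.
move=> [c ->]; suff [] : deg1 (\sum_i c i *: gen i) /\
  (\sum_i c i *: gen i) * (\sum_i c i *: gen i) = 0 by [].
apply: (big_ind (fun x : E => deg1 x /\ x * x = 0)).
- by split; [apply: deg1_0 | rewrite mul0r].
- move=> x y [dx xx] [dy yy]; split; first exact: deg1D.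
  by rewrite mulrDl !mulrDr xx yy add0r addr0 (deg1_anticomm dx dy) addNr.
- move=> i _; split; first exact/deg1Z/deg1_gen.
  by rewrite -scalerAl -scalerAr gen_sqr !scaler0.
Qed.

Lemma deg1_normal l f : deg1 l -> f * l = l * grade_inv f.
Proof.
move=> [c ->]; rewrite mulr_suml mulr_sumr; apply: eq_bigr => i _.
by rewrite -scalerAl -scalerAr grade_invM.
Qed.

Definition mono T : E := Ext [ffun A => (A == T)%:R].

Lemma coef_mono T A : coef (mono T) A = (A == T)%:R.
Proof. by rewrite /= ffunE. Qed.

Lemma ext_mono f : f = \sum_T coef f T *: mono T.
Proof.
apply: extP => A; rewrite coef_sum (bigD1 A) // coefZ coef_mono eqxx mulr1.
rewrite big1 => [|T /andP[_ /negPf TA]]; first by rewrite /= addr0.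
by rewrite coefZ coef_mono eq_sym TA mulr0.
Qed.

Lemma gen_mono i T : i \in T -> mono T = sgn i (T :\ i) *: (gen i * mono (T :\ i)).
Proof.
move=> iT; apply: extP => A; rewrite coefZ coef_genM !coef_mono.
case: ifPn => iA; last first.
  by rewrite mulr0; case: eqP iA => // ->; rewrite iT.
have -> : (A :\ i == T :\ i) = (A == T).
  by apply/eqP/eqP => [e|->//]; rewrite -(setD1K iA) e setD1K.
by case: eqP => [->|]; rewrite ?mulr0 // mulr1 sgn_sqr.
Qed.

(** Interior product with the functional e_j |-> c T j.  Letting the functional
    depend on the monomial T allows one operator to act by a different
    contraction on each summand of a decomposition of the algebra. *)
Definition contract (c : {set I} -> I -> k) f : E := Ext [ffun T : {set I} =>
  \sum_(j | j \notin T) c T j * sgn j T * coef f (j |: T)].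

Lemma coef_contract c f T : coef (contract c f) T =
  \sum_(j | j \notin T) c T j * sgn j T * coef f (j |: T).
Proof. by rewrite /= ffunE. Qed.

Lemma contractD c f g : contract c (f + g) = contract c f + contract c g.
Proof.
apply: extP => T; rewrite coefD !coef_contract -big_split; apply: eq_bigr => j _.
by rewrite coefD mulrDr.
Qed.

Lemma contractZ c a f : contract c (a *: f) = a *: contract c f.
Proof.
apply: extP => T; rewrite coefZ !coef_contract mulr_sumr; apply: eq_bigr => j _.
by rewrite coefZ; ring.
Qed.

Lemma contract0 c : contract c 0 = 0.
Proof. by rewrite -(scale0r (0 : E)) contractZ !scale0r. Qed.

Lemma contract_sum c (J : Type) (r : seq J) (F : J -> E) :
  contract c (\sum_(j <- r) F j) = \sum_(j <- r) contract c (F j).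
Proof. exact: (big_morph _ (contractD c) (contract0 c)). Qed.

(** Interior products are antiderivations.  The hypothesis says that
    multiplication by e_i does not leave the summand on which the functional is
    constant. *)
Lemma contract_genM c i f T : (forall S, c (i |: S) = c S) ->
  coef (contract c (gen i * f)) T =
  c T i * coef f T - coef (gen i * contract c f) T.
Proof.
move=> ci; rewrite coef_contract coef_genM; case: ifPn => iT; last first.
  rewrite subr0 (bigD1 i) //= coef_genM setU11 big1 ?addr0 => [|j /andP[jT ji]].
    by rewrite setU1K // -!mulrA (mulrA (sgn i T)) sgn_sqr mul1r.
  by rewrite coef_genM !inE eq_sym (negPf ji) (negPf iT) /= mulr0.
have cT : c (T :\ i) = c T by rewrite -ci setD1K.
rewrite coef_contract cT [in RHS](bigD1 i) /=; last by rewrite !inE eqxx.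
rewrite setD1K // mulrDr opprD addrA.
have -> : sgn i (T :\ i) * (c T i * sgn i (T :\ i) * coef f T) = c T i * coef f T.
  rewrite mulrC -!mulrA (mulrC (coef f T)) (mulrA (sgn _ _)) sgn_sqr mul1r.
  by [].
rewrite subrr sub0r mulr_sumr -sumrN; apply: eq_big => [j|j jT].
  rewrite !inE; case: (eqVneq j i) => [->|] /=; first by rewrite iT.
  by rewrite andbT.
have ji : j != i by apply: contraNneq jT => ->.
rewrite coef_genM !inE iT orbT.
have -> : (j |: T) :\ i = j |: (T :\ i).
  by apply/setP => a; rewrite !inE; case: (eqVneq a j) => [->|]; rewrite ?ji //= andbC.
have := @sgn_swap i j (T :\ i); rewrite eq_sym ji setD1K // !inE eqxx (negPf jT) andbF.
move=> /(_ isT isT isT) sw.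
transitivity (c T j * coef f (j |: T :\ i) * (sgn j T * sgn i (j |: T :\ i))); first ring.
have -> : sgn j T * sgn i (j |: T :\ i) = - (sgn j (T :\ i) * sgn i (T :\ i)).
  have e : sgn i (j |: T :\ i) = - (sgn j T * sgn i (T :\ i)) * sgn j (T :\ i).
    by rewrite -sw -mulrA sgn_sqr mulr1.
  rewrite e; transitivity (- ((sgn j T * sgn j T) * (sgn j (T :\ i) * sgn i (T :\ i)))).
    ring.
  by rewrite sgn_sqr mul1r.
ring.
Qed.

(** A contraction against a functional taking the value 1 on l is a contracting
    homotopy for multiplication by l; one taking the value 0 anticommutes with
    it. *)
Lemma contract_deg1M c l f T : deg1 l ->
  (forall i S, coef l [set i] != 0 -> c (i |: S) = c S) ->
  coef (contract c (l * f)) T =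
  (\sum_i coef l [set i] * c T i) * coef f T - coef (l * contract c f) T.
Proof.
move=> dl cl; rewrite {1 3}(deg1_coef dl) !mulr_suml contract_sum !coef_sum.
rewrite -sumrB; apply: eq_bigr => i _; rewrite -!scalerAl contractZ !coefZ.
have [->|ci] := eqVneq (coef l [set i]) 0; first by rewrite !mul0r subr0.
rewrite contract_genM; first ring.
by move=> S; apply: cl.
Qed.

Lemma coef_deg1M l f T : deg1 l -> coef (l * f) T =
  \sum_(i in T) coef l [set i] * sgn i (T :\ i) * coef f (T :\ i).
Proof.
move=> dl; rewrite {1}(deg1_coef dl) mulr_suml coef_sum [RHS]big_mkcond.
apply: eq_bigr => i _; rewrite -scalerAl coefZ coef_genM.
by case: ifP; rewrite ?mulr0 ?mulrA.
Qed.

End ExteriorFacts.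

(** * Regularity modulo left ideals *)

Section Regularity.
Variables (k : fieldType) (I : finType).
Local Notation E := (ext k I).
Implicit Types (J : E -> Prop) (l x y z : E) (s : seq E).

Definition left_ideal J : Prop :=
  J 0 /\ forall a x y, J x -> J y -> J (a * x + y).

(** The preimage in the algebra of l * (E / J).  Right multiples of l are the
    convenient form; for l of degree one they make a left ideal. *)
Definition adjoin J l : E -> Prop := fun x => exists w, J (x - l * w).

(** Only half of regularity: l * l = 0 gives the other inclusion. *)
Definition regular_mod J l : Prop :=
  forall y, J (l * y) -> exists z, J (y - l * z).

Section LeftIdeal.
Variable J : E -> Prop.
Hypothesis idJ : left_ideal J.

Lemma left_ideal0 : J 0. Proof. by case: idJ. Qed.

Lemma left_idealM a x : J x -> J (a * x).
Proof. by case: idJ => J0 JD Jx; rewrite -[a * x]addr0; apply: JD. Qed.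

Lemma left_idealD x y : J x -> J y -> J (x + y).
Proof. by case: idJ => _ JD Jx Jy; rewrite -[x]mul1r; apply: JD. Qed.

Lemma left_idealN x : J x -> J (- x).
Proof. by rewrite -mulN1r; apply: left_idealM. Qed.

Lemma left_idealB x y : J x -> J y -> J (x - y).
Proof. by move=> Jx Jy; apply/left_idealD/left_idealN. Qed.

Lemma left_idealZ (c : k) x : J x -> J (c *: x).
Proof. by rewrite -[x in c *: x]mul1r scalerAl; apply: left_idealM. Qed.

Lemma left_ideal_sum (K : Type) (r : seq K) (F : K -> E) :
  (forall a, J (F a)) -> J (\sum_(a <- r) F a).
Proof. by move=> JF; apply: big_ind => //; [apply: left_ideal0 | apply: left_idealD]. Qed.

Lemma adjoin_left_ideal l : deg1 l -> left_ideal (adjoin J l).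
Proof.
move=> dl; split=> [|a x y [w Jx] [v Jy]].
  by exists 0; rewrite mulr0 subr0; apply: left_ideal0.
exists (grade_inv a * w + v); rewrite mulrDr mulrA -deg1_normal //.
rewrite -mulrA; have -> : a * x + y - (a * (l * w) + l * v) =
  a * (x - l * w) + (y - l * v) by rewrite mulrBr opprD addrACA.
by apply: left_idealD => //; apply: left_idealM.
Qed.

Lemma adjoin_sub l x : J x -> adjoin J l x.
Proof. by exists 0; rewrite mulr0 subr0. Qed.

Lemma adjoin_mul l w : adjoin J l (l * w).
Proof. by exists w; rewrite subrr; apply: left_ideal0. Qed.

(** With M = E/J, multiplication by l1 identifies M / l1 M with l1 M when l1 is
    regular, up to a sign in the action of l.  So l is exact on both ends of
    0 -> l1 M -> M -> M / l1 M -> 0, hence on M.  The proof is the corresponding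
    diagram chase on representatives. *)
Lemma regular_mod_adjoin l1 l : deg1 l1 -> deg1 l ->
  regular_mod J l1 -> regular_mod (adjoin J l1) l -> regular_mod J l.
Proof.
move=> d1 dl reg1 regl y Jly.
have [z [w Jw]] := regl y (adjoin_sub l1 Jly).
have /reg1[u Ju] : J (l1 * (l * w)).
  rewrite mulrA (deg1_anticomm d1 dl) mulNr -mulrA; apply: left_idealN.
  have -> : l * (l1 * w) = l * y - l * (y - l * z - l1 * w).
    by rewrite !mulrBr [l * (l * z)]mulrA (deg1_sqr dl) mul0r subr0 opprB addrCA subrr addr0.
  by apply: left_idealB => //; apply: left_idealM.
have [v [t Jt]] : exists z, adjoin J l1 (w - l * z).
  by apply: regl; exists u.
exists (z - l1 * v).
have -> : y - l * (z - l1 * v) = (y - l * z - l1 * w) + l1 * (w - l * v - l1 * t).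
  rewrite !mulrBr [l1 * (l1 * t)]mulrA (deg1_sqr d1) mul0r subr0.
  rewrite [l1 * (l * v)]mulrA (deg1_anticomm d1 dl) mulNr -mulrA opprK opprB.
  by rewrite [RHS]addrA subrK addrA addrAC.
by apply: left_idealD => //; apply: left_idealM.
Qed.

Lemma regular_mod_congr l l' (c : k) : c != 0 ->
  (forall x, J ((l - c *: l') * x)) -> regular_mod J l' -> regular_mod J l.
Proof.
move=> c0 Jl reg y Jy.
have /reg[z Jz] : J (l' * y).
  have -> : l' * y = c^-1 *: (l * y - (l - c *: l') * y).
    by rewrite mulrBl opprB addrCA subrr addr0 -scalerAl scalerK.
  by apply: left_idealZ; apply: left_idealB.
exists (c^-1 *: z).
have -> : y - l * (c^-1 *: z) = (y - l' * z) - (l - c *: l') * (c^-1 *: z).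
  rewrite mulrBl -scalerAl -(scalerAr c^-1 l') scalerA divff // scale1r.
  by rewrite opprB addrA subrK.
by apply: left_idealB.
Qed.

End LeftIdeal.

Definition adjoin_seq J s : E -> Prop := foldl adjoin J s.

Lemma adjoin_seq_rcons J s l : adjoin_seq J (rcons s l) = adjoin (adjoin_seq J s) l.
Proof. by rewrite /adjoin_seq foldl_rcons. Qed.

Lemma adjoin_seq_left_ideal J s : left_ideal J ->
  (forall l, l \in s -> deg1 l) -> left_ideal (adjoin_seq J s).
Proof.
move=> idJ; elim/last_ind: s => [//|s l IH] ds; rewrite adjoin_seq_rcons.
apply: adjoin_left_ideal; last by apply: ds; rewrite mem_rcons mem_head.
by apply: IH => m ms; apply: ds; rewrite mem_rcons inE ms orbT.
Qed.

Lemma adjoin_seq_sub J s x : J x -> adjoin_seq J s x.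
Proof.
elim/last_ind: s x => [//|s l IH] x Jx; rewrite adjoin_seq_rcons.
by exists 0; rewrite mulr0 subr0; apply: IH.
Qed.

Lemma adjoin_seq_mul J s l w : left_ideal J -> (forall l, l \in s -> deg1 l) ->
  l \in s -> adjoin_seq J s (l * w).
Proof.
move=> idJ; elim/last_ind: s => [//|s m IH] ds.
have ds' l' : l' \in s -> deg1 l'.
  by move=> ls; apply: ds; rewrite mem_rcons inE ls orbT.
rewrite mem_rcons inE adjoin_seq_rcons => /predU1P[->|ls].
  by apply: adjoin_mul; apply: adjoin_seq_left_ideal.
by apply: adjoin_sub; apply: IH.
Qed.

Definition regular_seq_mod J s : Prop := forall i, (i < size s)%N ->
  deg1 s`_i /\ regular_mod (adjoin_seq J (take i s)) s`_i.

(** Modulo the forms preceding the last one with a nonzero coefficient, the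
    combination is a multiple of that form, hence regular; the preceding forms
    are then removed one at a time with [regular_mod_adjoin]. *)
Lemma regular_seq_comb J s (c : 'I_(size s) -> k) :
  left_ideal J -> regular_seq_mod J s -> (exists i, c i != 0) ->
  regular_mod J (\sum_i c i *: s`_i).
Proof.
move=> idJ regs [i0 ci0].
have ds l : l \in s -> deg1 l.
  by move=> /(nthP 0)[i /regs[] di _ <-].
have idt n : left_ideal (adjoin_seq J (take n s)).
  by apply: adjoin_seq_left_ideal => // l /mem_take; apply: ds.
set l := \sum_i _.
have dl : deg1 l.
  by apply: deg1_sum => i; apply: deg1Z; apply: ds; apply: mem_nth.
case: (@arg_maxnP _ i0 (fun i => c i != 0) val ci0) => i ci imax.
have regi : regular_mod (adjoin_seq J (take i s)) l.
  apply: (@regular_mod_congr _ (idt i) _ s`_i (c i)) => //; last by case: (regs i).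
  move=> x; rewrite /l (bigD1 i) //= [c i *: _ + _]addrC addrK mulr_suml.
  rewrite big_mkcond; apply: left_ideal_sum => // j; case: ifP => [ji|_]; last exact: left_ideal0.
  have [cj|cj] := eqVneq (c j) 0; first by rewrite cj scale0r mul0r; apply: left_ideal0.
  rewrite -scalerAl; apply: left_idealZ => //; apply: adjoin_seq_mul => //.
    by move=> l' /mem_take; apply: ds.
  have lt_ji : (j < i)%N by rewrite ltn_neqAle ji; apply: imax.
  by rewrite -(nth_take 0 lt_ji) mem_nth // size_take ltn_ord.
(* The preceding forms are removed by descent on the length of the prefix. *)
have: (i < size s)%N by [].
elim: {i ci imax}(val i) regi => [|i IH] regi lt_is; first by rewrite take0 in regi.
apply: IH; last exact: ltnW.
have [di reg1] := regs i (ltnW lt_is).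
apply: (regular_mod_adjoin (idt i) di dl reg1).
by rewrite -adjoin_seq_rcons -take_nth // ltnW.
Qed.

End Regularity.

Section Transfer.
Variables (k : fieldType) (I : finType).
Local Notation E := (ext k I).
Variable N : submodClosed (E^o).
Local Notation M := (qmod N).
Local Notation inN := (fun x : E => (x : E^o) \in N).
Local Open Scope quotient_scope.

Lemma submod_left_ideal : left_ideal inN.
Proof.
split=> [|a x y xN yN]; first exact: (rpred0 N).
by apply: (@rpredD _ N) => //; apply: (@rpredZ _ _ N a).
Qed.

(** Bridges the submodule (s) M of the quotient module with an explicit left
    ideal of the algebra, so that regularity can be argued on representatives. *)
Lemma ideal_mulP (s : seq E) (x : E) : (forall l, l \in s -> deg1 l) ->
  (\pi_M (x : E^o)) \in ideal_mul (ideal_gen (fun l : E => l \in s)) M <->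
  adjoin_seq inN s x.
Proof.
move=> ds; have idN := submod_left_ideal.
have idJ := adjoin_seq_left_ideal idN ds.
set J := adjoin_seq _ s in idJ *.
have Jpi (y z : E^o) : \pi_M y = \pi_M z -> J y -> J z.
  move/eqP; rewrite qmod_eq => yz Jy; rewrite -[z](subKr y).
  by apply: left_idealB => //; apply: adjoin_seq_sub.
split.
- move=> /asboolP[t [tX e]].
  suff : J (repr (\pi_M (x : E^o))) by apply: Jpi; rewrite reprK.
  rewrite e; elim: t tX {e} => [|p t IH] tX.
    rewrite big_nil; apply: (Jpi 0); last exact: left_ideal0.
    by rewrite reprK (raddf0 \pi_(Quotient.quot (zmod_of_submod N))).
  rewrite big_cons.
  have {}IH : J (repr (\sum_(q <- t) q.1 *: q.2 : M)).
    by apply: IH => q qt; apply: tX; rewrite inE qt orbT.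
  have /tX[a aX [m ->]] : p \in p :: t by rewrite mem_head.
  apply: (Jpi ((p.1 : E) * ((a : E) * (repr m : E)) + repr (\sum_(q <- t) q.1 *: q.2 : M))).
    rewrite reprK qmodD reprK; congr (_ + _).
    by rewrite -[m in RHS]reprK [X in _ *: X]qmod_scaleE [RHS]qmod_scaleE.
  apply: left_idealD => //; apply: left_idealM => //.
  move: aX => /asboolP[u [uX ->]]; rewrite mulr_suml.
  rewrite big_seq; apply: big_ind => //; first exact: left_ideal0.
    by move=> *; apply: left_idealD.
  move=> q /uX[l ls [b ->]].
  have -> : (q.1 *: (l * b : E^o)) * (repr m : E) = q.1 * (l * (b * (repr m : E))) :> E.
    by rewrite -[q.1 *: _]/((q.1 : E) * (l * b)) -!mulrA.
  by apply: left_idealM => //; apply: adjoin_seq_mul.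
- rewrite /J; have: {subset s <= s} by [].
  move: {1 3}s => s'; elim/last_ind: s' x => [|s' l IH] x ss.
    rewrite /adjoin_seq /= => xN.
    have /eqP -> : \pi_M (x : E^o) == \pi_M (0 : E^o) by rewrite qmod_eq subr0.
    by rewrite (raddf0 \pi_(Quotient.quot (zmod_of_submod N))) rpred0.
  rewrite adjoin_seq_rcons => -[w Jw].
  have -> : \pi_M (x : E^o) = \pi_M (x - l * w : E^o) + l *: \pi_M (w : E^o).
    by rewrite [X in _ + X]qmod_scaleE -qmodD subrK.
  apply: rpredD.
    by apply: IH => // m ms; apply: ss; rewrite mem_rcons inE ms orbT.
  apply/asboolP; exists [:: (1, l *: \pi_M (w : E^o))]; split; last first.
    by rewrite big_seq1 scale1r.
  move=> q; rewrite inE => /eqP -> /=; exists l; last by exists (\pi_M (w : E^o)).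
  apply/asboolP; exists [:: (1, l : E^o)]; split; last first.
    by rewrite big_seq1 scale1r.
  move=> r; rewrite inE => /eqP -> /=; exists l; last by exists 1; rewrite mulr1.
  by apply: ss; rewrite mem_rcons mem_head.
Qed.

Lemma reg_eltP (s : seq E) (l : E) : (forall l, l \in s -> deg1 l) -> deg1 l ->
  reg_elt (qmod (ideal_mul (ideal_gen (fun x : E => x \in s)) M)) l <->
  regular_mod (adjoin_seq inN s) l.
Proof.
move=> ds dl; set K := ideal_mul _ _.
have pi0 (x : E) : \pi_(qmod K) (\pi_M (x : E^o)) = 0 <-> adjoin_seq inN s x.
  rewrite -(ideal_mulP x ds) -/K -(raddf0 \pi_(Quotient.quot (zmod_of_submod K))).
  split=> [/eqP|xK]; first by rewrite [_ == _]qmod_eq subr0.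
  by apply/eqP; rewrite [_ == _]qmod_eq subr0.
have piM (x : E) : l *: \pi_(qmod K) (\pi_M (x : E^o)) = \pi_(qmod K) (\pi_M (l * x : E^o)).
  by rewrite [LHS]qmod_scaleE; congr (\pi_ _ _); rewrite [LHS]qmod_scaleE.
have piB (x y : E) : \pi_(qmod K) (\pi_M (x : E^o)) = \pi_(qmod K) (\pi_M (y : E^o)) <->
    adjoin_seq inN s (x - y).
  rewrite -pi0; have -> : \pi_M (x - y : E^o) = \pi_M (x : E^o) - \pi_M (y : E^o).
    exact: (raddfB \pi_(Quotient.quot (zmod_of_submod N))).
  have -> : \pi_(qmod K) (\pi_M (x : E^o) - \pi_M (y : E^o)) =
      \pi_(qmod K) (\pi_M (x : E^o)) - \pi_(qmod K) (\pi_M (y : E^o)).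
    exact: (raddfB \pi_(Quotient.quot (zmod_of_submod K))).
  by split=> [->|/subr0_eq //]; rewrite subrr.
have lift (u : qmod K) : exists x : E, u = \pi_(qmod K) (\pi_M (x : E^o)).
  by exists (repr (repr u)); rewrite !reprK.
split=> [reg y Jy|reg u].
  have /reg[v] : l *: \pi_(qmod K) (\pi_M (y : E^o)) = 0 by rewrite piM; apply/pi0.
  by have [z ->] := lift v; rewrite piM => /piB; exists z.
have [y ->] := lift u; rewrite piM; split=> [/pi0/reg[z Jz]|[v]].
  by exists (\pi_(qmod K) (\pi_M (z : E^o))); rewrite piM; apply/piB.
have [z ->] := lift v; rewrite piM => /piB Jz; apply/pi0.
have idJ := adjoin_seq_left_ideal submod_left_ideal ds.
have -> : l * y = l * (y - l * z) by rewrite mulrBr mulrA deg1_sqr // mul0r subr0.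
exact: left_idealM.
Qed.

Lemma reg_seqP (s : seq E) : reg_seq M s <-> regular_seq_mod inN s.
Proof.
have dt : (forall i, (i < size s)%N -> deg1 s`_i) -> forall n l, l \in take n s -> deg1 l.
  by move=> ds n l /mem_take/(nthP 0)[i /ds di <-].
split=> reg i lt_is; have [di ri] := reg i lt_is; split=> //.
  by apply/reg_eltP => //; apply: dt => j /reg[].
by apply/reg_eltP => //; apply: dt => j /reg[].
Qed.

End Transfer.

(** * Edge ideals and the parity of the number of independent sets *)

(** Kernel and image coincide, so the rank is half of the dimension. *)
Lemma exact_even (k : fieldType) N (L : 'M[k]_N) : L *m L = 0 ->
  (forall v : 'rV_N, v *m L = 0 -> exists u : 'rV_N, v = u *m L) -> ~~ odd N.
Proof.
move=> LL ex.
have kL : (kermx L <= L)%MS.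
  apply/row_subP => i; have [|u ->] := ex (row i (kermx L)).
    by rewrite -row_mul mulmx_ker row0.
  exact: submxMl.
have Lk : (L <= kermx L)%MS by apply/sub_kermxP.
have := mxrank_ker L; have /eqP <- : \rank L == \rank (kermx L).
  by rewrite eqn_leq !mxrankS.
move=> e.
by rewrite -(subnK (rank_leq_row L)) -e addnn odd_double.
Qed.

Section EdgeIdeal.
Variables (k : fieldType) (H : sgraph).
Local Notation E := (ext k H).
Local Notation inI := (fun x : E => (x : E^o) \in edge_ideal k H).
Implicit Types (f x y z l : E) (S T : {set H}).

Lemma independentP T :
  reflect (forall u v, u \in T -> v \in T -> ~~ edge u v) (independent T).
Proof.
apply: (iffP forall_inP) => [h u v uT vT|h u uT].
  by have /forall_inP := h u uT; apply.
by apply/forall_inP => v; apply: h.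
Qed.

Lemma independentS S T : S \subset T -> independent T -> independent S.
Proof.
move=> /subsetP ST /independentP h; apply/independentP => u v uS vS.
by apply: h; apply: ST.
Qed.

(** The edge ideal is a monomial ideal, spanned by the dependent vertex sets. *)
Lemma edge_idealP f : inI f <-> (forall T, independent T -> coef f T = 0).
Proof.
split=> [/asboolP[s [sX ->]] T /independentP indT|f0].
  rewrite big_seq coef_sum big1 // => p /sX[_ [i [j [ij ->]]] [b ->]].
  rewrite -[p.1 *: _]/((p.1 : E) * (gen k i * gen k j * b)) coefM big1 // => A AT.
  rewrite -[_ * b]mulrA !coef_genM !inE.
  case: ifPn => [iT|_]; last by rewrite mulr0.
  case: ifPn => [/andP[_ jT]|_]; last by rewrite !mulr0.
  case/andP: iT => _ iT; case/andP: jT => _ jT.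
  by have := indT i j iT jT; rewrite ij.
rewrite (ext_mono f); apply: rpred_sum => T _.
have [indT|] := boolP (independent T); first by rewrite f0 // scale0r rpred0.
move=> /forall_inPn[i iT /forall_inPn[j jT /negPn ij]].
have ji : j != i by apply: contraTneq ij => ->; rewrite edge_irrefl.
have jT' : j \in T :\ i by rewrite !inE ji.
rewrite (gen_mono k iT) (gen_mono k jT') -scalerAr mulrA !scalerA.
set c := _ * _.
apply/asboolP; exists [:: (c%:A, gen k i * gen k j * mono k (T :\ i :\ j) : E^o)].
split=> [p|]; last by rewrite big_seq1 -[_ *: _ in RHS]/(c%:A * _) -scalerAl mul1r.
rewrite inE => /eqP -> /=; exists (gen k i * gen k j); first by exists i, j.
by exists (mono k (T :\ i :\ j)).
Qed.

Lemma edge_ideal_left_ideal : left_ideal inI.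
Proof. exact: submod_left_ideal. Qed.

(** Multiplication by l preserves the span of the monomials on subsets of F, and
    also the span of the other monomials.  The image of the former is therefore a
    direct summand of the quotient, inherits the exactness of l, and so has even
    dimension. *)
Lemma regular_even l (F : {set H}) : deg1 l ->
  (forall i, i \notin F -> coef l [set i] = 0) -> regular_mod inI l ->
  ~~ odd #|[set T : {set H} | independent T && (T \subset F)]|.
Proof.
move=> dl lF reg; set P := [set T | _].
have downP S T : S \subset T -> T \in P -> S \in P.
  rewrite !inE => ST /andP[indT TF].
  by rewrite (independentS ST indT) (subset_trans ST TF).
(* Coordinates on the span of P, and multiplication by l in these coordinates. *)
pose restr f : 'rV_#|P| := \row_a coef f (enum_val a).
pose lift (v : 'rV_#|P|) : E := \sum_a v 0 a *: mono k (enum_val a).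
have coef_lift v a : coef (lift v) (enum_val a) = v 0 a.
  rewrite coef_sum (bigD1 a) // big1 => [|b /andP[_ ba]].
    by rewrite coefZ coef_mono eqxx mulr1 /= addr0.
  by rewrite coefZ coef_mono (inj_eq enum_val_inj) eq_sym (negPf ba) mulr0.
have coef_liftN v T : T \notin P -> coef (lift v) T = 0.
  move=> nP; rewrite coef_sum big1 // => a _; rewrite coefZ coef_mono.
  by case: eqP nP => [->|]; rewrite ?enum_valP ?mulr0.
have coef_lift_restr f T : T \in P -> coef (lift (restr f)) T = coef f T.
  by move=> TP; rewrite -(enum_rankK_in TP TP) coef_lift mxE.
pose L : 'M[k]_#|P| := \matrix_(a, b) coef (l * mono k (enum_val a)) (enum_val b).
have mulL v : v *m L = restr (l * lift v).
  apply/rowP => b; rewrite !mxE mulr_sumr coef_sum; apply: eq_bigr => a _.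
  by rewrite mxE -scalerAr coefZ.
have restrL f : restr f *m L = restr (l * f).
  rewrite mulL; apply/rowP => b; rewrite !mxE !coef_deg1M //.
  apply: eq_bigr => i _; rewrite coef_lift_restr //.
  by apply: downP (enum_valP b); apply: subD1set.
have liftK v : restr (lift v) = v by apply/rowP => a; rewrite mxE coef_lift.
apply: (@exact_even _ _ L) => [|v vL].
  apply/row_matrixP => a; rewrite row0 row_mul.
  have -> : row a L = restr (l * mono k (enum_val a)) by apply/rowP => b; rewrite !mxE.
  by rewrite restrL mulrA deg1_sqr // mul0r; apply/rowP => b; rewrite !mxE ffunE.
have /reg[z /edge_idealP Iz] : inI (l * lift v).
  apply/edge_idealP => T indT; have [TP|nTP] := boolP (T \in P).
    rewrite -(enum_rankK_in TP TP); move/rowP: vL => /(_ (enum_rank_in TP T)).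
    by rewrite mulL !mxE.
  rewrite coef_deg1M // big1 // => i iT.
  have [iF|/lF ->] := boolP (i \in F); last by rewrite !mul0r.
  rewrite coef_liftN ?mulr0 //; apply: contra nTP; rewrite !inE indT => /andP[_ TF].
  by rewrite -(setD1K iT) subUset sub1set iF.
exists (restr z); rewrite restrL -[LHS]liftK; apply/rowP => a; rewrite !mxE.
apply/eqP; rewrite -subr_eq0 -coefB; apply/eqP; apply: Iz.
by have := enum_valP a; rewrite inE => /andP[].
Qed.

End EdgeIdeal.

Section WhiskerGraph.
Variable G : sgraph.
Implicit Types (T : {set whisker G}) (S A B : {set G}).

Definition base T : {set G} := [set v | (inl v : whisker G) \in T].
Definition leaves T : {set G} := [set v | (inr v : whisker G) \in T].

Lemma whisker_independent T :
  independent T = independent (base T) && [disjoint base T & leaves T].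
Proof.
apply/independentP/andP => [indT|[/independentP indb /pred0P dis] [] u [] v uT vT //].
- split; first by apply/independentP => u v; rewrite !inE; apply: (indT (inl u) (inl v)).
  apply/pred0P => v /=; rewrite !inE; apply/negP => /andP[vT v'T].
  by have := indT _ _ vT v'T; rewrite /= eqxx.
- by apply: indb; rewrite inE.
- by apply/eqP => uv; have := dis u; rewrite /= !inE uT uv vT.
- by apply/eqP => uv; have := dis v; rewrite /= !inE vT -uv uT.
Qed.

Definition half_whisker A : {set whisker G} :=
  [set a | if a is inr v then v \in A else true].

(** Grouping the independent sets by their trace S on G gives the sum over S of
    2 ^ |A \ S|; by maximality of A, only S = A contains A, so all other terms
    are even. *)
Lemma card_half_whisker_odd A : independent A ->
  (forall S, independent S -> A \subset S -> S = A) ->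
  odd #|[set T : {set whisker G} | independent T && (T \subset half_whisker A)]|.
Proof.
move=> indA maxA; set P := [set T | _].
pose glue S B : {set whisker G} :=
  [set a | match a with inl v => v \in S | inr v => v \in B end].
have baseG S B : base (glue S B) = S by apply/setP => v; rewrite !inE.
have leavesG S B : leaves (glue S B) = B by apply/setP => v; rewrite !inE.
have glueK T : glue (base T) (leaves T) = T by apply/setP => -[v|v]; rewrite !inE.
(* The leaves of a member of P form an arbitrary subset of A off its base. *)
have memP T : (T \in P) = independent (base T) && (leaves T \subset A :\: base T).
  rewrite inE whisker_independent -andbA subsetD disjoint_sym.
  congr (_ && _); rewrite andbC; congr (_ && _);
    apply/subsetP/subsetP => [h v|h [v|v] vT]; rewrite ?inE //.
    by move=> /h; rewrite inE.
  by apply: h; rewrite inE.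
have fiber S : #|[set T in P | base T == S]| =
    if independent S then (2 ^ #|A :\: S|)%N else 0%N.
  case: ifP => indS; last first.
    apply/eqP; rewrite cards_eq0; apply/eqP/setP => T; rewrite !inE.
    by case: eqP => [bS|]; rewrite ?andbF // andbT whisker_independent bS indS.
  rewrite -card_powerset -(card_imset _ (can_inj (leavesG S))).
  apply: eq_card => T; rewrite inE memP; apply/andP/imsetP => [[/andP[_ lT] /eqP <-]|[B]].
    by exists (leaves T); rewrite ?inE.
  by rewrite inE => BA ->; rewrite baseG leavesG indS BA eqxx.
rewrite -sum1_card (partition_big base predT) //= (bigD1 A) //= oddD.
have sumfib S : (\sum_(T in P | base T == S) 1 = #|[set T in P | base T == S]|)%N.
  by rewrite -sum1_card; apply: eq_bigl => T; rewrite [RHS]inE.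
rewrite sumfib fiber indA setDv cards0 /= -dvdn2; apply: dvdn_sum => S SA.
rewrite sumfib fiber; case: ifP => // indS; rewrite dvdn2 oddX /= orbF.
by rewrite cards_eq0 setD_eq0; apply: contra SA => /(maxA _ indS) ->.
Qed.

End WhiskerGraph.

(** * Depth of the whisker graph *)

(** A divided difference: a functional supported on B whose values on the moment
    vectors (t_v ^ j), j <= i, single out j = i. *)
Lemma vandermonde_dual (k : fieldType) (V : finType) (t : V -> k) (B : {set V})
    (i : nat) :
  injective t -> (i < #|B|)%N ->
  exists d : V -> k, (forall v, v \notin B -> d v = 0) /\
    (forall j, (j <= i)%N -> \sum_v t v ^+ j * d v = (j == i)%:R).
Proof.
move=> tI iB; pose b (a : 'I_i.+1) : V := enum_val (widen_ord iB a).
have bI : injective b by move=> a c /enum_val_inj [ac]; apply: val_inj.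
pose W : 'M[k]_i.+1 := Vandermonde i.+1 (\row_a t (b a)).
have Wu : W \in unitmx.
  rewrite unitmxE det_Vandermonde unitfE; apply/prodf_neq0 => a _.
  apply/prodf_neq0 => c ac; rewrite !mxE subr_eq0; apply: contraTneq ac => /tI/bI ->.
  by rewrite ltnn.
pose e := col ord_max (invmx W).
exists (fun v => \sum_(a | b a == v) e a 0); split=> [v vB|j ji].
  rewrite big_pred0 // => a; apply: contraNF vB => /eqP <-; exact: enum_valP.
have jlt : (j < i.+1)%N by [].
have := congr1 (fun M : 'M_(_, _) => M (Ordinal jlt) ord_max) (mulmxV Wu).
rewrite !mxE -val_eqE /= => <-.
under eq_bigr do rewrite mulr_sumr.
rewrite (exchange_big_dep predT) //=; apply: eq_bigr => a _.
by rewrite (big_pred1 (b a)) ?mxE.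
Qed.

Section Depth.
Variables (k : fieldType) (G : sgraph).
Local Notation H := (whisker G).
Local Notation E := (ext k H).
Local Notation inI := (fun x : E => (x : E^o) \in edge_ideal k H).

Section LowerBound.
Variable t : G -> k.
Hypothesis t_inj : injective t.

Definition moment_form (j : nat) : E := \sum_v t v ^+ j *: gen k (inr v : H).

Lemma deg1_moment j : deg1 (moment_form j).
Proof. by apply: deg1_sum => v; apply/deg1Z/deg1_gen. Qed.

Lemma coef_moment_base j v : coef (moment_form j) [set (inl v : H)] = 0.
Proof.
rewrite coef_sum big1 // => w _; rewrite coefZ coef_gen (inj_eq set1_inj).
by rewrite mulr0.
Qed.

Lemma coef_moment_leaf j v : coef (moment_form j) [set (inr v : H)] = t v ^+ j.
Proof.
rewrite coef_sum (bigD1 v) // big1 => [|w /andP[_ wv]].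
  by rewrite coefZ coef_gen eqxx mulr1 /= addr0.
rewrite coefZ coef_gen (inj_eq set1_inj).
case: eqP => [[vw]|_]; last by rewrite mulr0.
by rewrite vw eqxx in wv.
Qed.

(** The bound says that enough leaves remain off every independent set S for the
    m moment forms to stay linearly independent there. *)
Lemma moment_seq_regular m :
  (forall S : {set G}, independent S -> (m + #|S| <= #|G|)%N) ->
  regular_seq_mod inI (mkseq moment_form m).
Proof.
move=> small i; rewrite size_mkseq => im; rewrite nth_mkseq //.
split; first exact: deg1_moment.
have -> : take i (mkseq moment_form m) = mkseq moment_form i.
  by rewrite /mkseq -map_take take_iota (minn_idPl (ltnW im)).
have idI := edge_ideal_left_ideal k H.
have idJ n : left_ideal (adjoin_seq inI (mkseq moment_form n)).
  by apply: adjoin_seq_left_ideal => // l /mapP[j _ ->]; apply: deg1_moment.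
(* Summands indexed by dependent S lie in the edge ideal; the zero functional
   is used there. *)
have /choice[d dP] : forall S : {set G}, exists d : G -> k,
    (forall v, v \in S -> d v = 0) /\
    (forall j, (j <= i)%N -> \sum_v t v ^+ j * d v = (independent S && (j == i))%:R).
  move=> S; have [indS|_] := boolP (independent S); last first.
    by exists (fun=> 0); split=> // j _; rewrite big1 // => v _; rewrite mulr0.
  have lt_iS : (i < #|~: S|)%N.
    by rewrite cardsCs setCK ltn_subRL addnC; apply: leq_trans (small S indS); rewrite ltn_add2r.
  have [d [d0 dd]] := vandermonde_dual t_inj lt_iS.
  by exists d; split=> // v vS; apply: d0; rewrite inE vS.
pose c (T : {set H}) (a : H) := if a is inr v then d (base T) v else 0.
have cP j f T : (j <= i)%N -> coef (contract c (moment_form j * f)) T =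
    (independent (base T) && (j == i))%:R * coef f T - coef (moment_form j * contract c f) T.
  move=> ji; rewrite contract_deg1M; first last.
  - move=> [v|v] S; first by rewrite coef_moment_base eqxx.
    move=> _; rewrite /c (_ : base (_ |: S) = base S) //.
    by apply/setP => w; rewrite !inE.
  - exact: deg1_moment.
  congr (_ * _ - _); have [_ /(_ j ji) <-] := dP (base T).
  rewrite big_sumType /= big1 ?add0r => [|v _]; last by rewrite mulr0.
  by apply: eq_bigr => v _; rewrite coef_moment_leaf.
(* Contracting away a leaf y_v turns a dependent set into an independent one
   only if v is in the base, where the functional vanishes. *)
have cI f : inI f -> inI (contract c f).
  move=> /edge_idealP f0; apply/edge_idealP => T indT.
  rewrite coef_contract big1 // => -[v|v] vT; first by rewrite !mul0r.
  have [d0 _] := dP (base T); have [vb|vb] := boolP (v \in base T).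
    by rewrite /c d0 // !mul0r.
  rewrite f0 ?mulr0 //; move: indT; rewrite !whisker_independent => /andP[indb dis].
  have -> : base (inr v |: T) = base T by apply/setP => w; rewrite !inE.
  rewrite indb /=; apply/pred0P => w; rewrite /= !inE; case: eqP => [[->]|_] /=.
    by rewrite andbT; apply: contraNF vb; rewrite inE.
  by have /pred0P/(_ w) := dis; rewrite /= !inE.
have cJ n x : (n <= i)%N -> adjoin_seq inI (mkseq moment_form n) x ->
    adjoin_seq inI (mkseq moment_form n) (contract c x).
  elim: n x => [|n IH] x ni; first exact: cI.
  rewrite mkseqS adjoin_seq_rcons => -[w Jw]; exists (- contract c w).
  have {Jw}/(IH _ (ltnW ni)) : adjoin_seq inI (mkseq moment_form n) (x - moment_form n * w) by [].
  rewrite contractD -[- (_ * w)]scaleN1r contractZ scaleN1r.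
  suff -> : contract c (moment_form n * w) = moment_form n * - contract c w by [].
  rewrite mulrN; apply: extP => T; rewrite cP ?(ltnW ni) // ltn_eqF // andbF mul0r sub0r.
  by rewrite coefN.
(* Modulo the edge ideal, y = contract (l y) + l contract y. *)
move=> y /cJ Jy; exists (contract c y).
set l := moment_form i in Jy *.
have -> : y - l * contract c y =
    contract c (l * y) + (y - (contract c (l * y) + l * contract c y)).
  by rewrite opprD (addrCA y) addNKr.
apply: left_idealD => //; first exact: Jy.
apply: adjoin_seq_sub; apply/edge_idealP => T.
rewrite whisker_independent => /andP[indb _].
rewrite coefB coefD cP // indb eqxx mul1r subrK.
by rewrite subrr.
Qed.

End LowerBound.

(** A longer sequence would have a nontrivial combination with no coefficient at
    the leaves outside A, by counting linear conditions; this contradicts parity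
    of the number of independent sets of the half-whiskered graph. *)
Lemma regular_seq_size s (A : {set G}) : independent A ->
  (forall S, independent S -> A \subset S -> S = A) ->
  regular_seq_mod inI s -> (size s <= #|~: A|)%N.
Proof.
move=> indA maxA regs; rewrite leqNgt; apply/negP => lt_As.
have ds (j : 'I_(size s)) : deg1 s`_j by case: (regs j).
pose Q := \matrix_(j < size s, b < #|~: A|) coef s`_j [set (inr (enum_val b) : H)].
have kQ : kermx Q != 0.
  rewrite -mxrank_eq0 mxrank_ker -lt0n subn_gt0.
  exact: leq_ltn_trans (rank_leq_col Q) lt_As.
pose c := nz_row (kermx Q).
have cQ : c *m Q = 0 by apply/sub_kermxP; apply: nz_row_sub.
have /rV0Pn[j0 cj0] : c != 0 by rewrite nz_row_eq0.
have idI := edge_ideal_left_ideal k H.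
have regl := regular_seq_comb idI regs (ex_intro _ j0 cj0).
set l := \sum_i _ in regl.
have dl : deg1 l by apply: deg1_sum => j; apply/deg1Z/ds.
have lF i : i \notin half_whisker A -> coef l [set i] = 0.
  case: i => v; rewrite inE // => vA; have vA' : v \in ~: A by rewrite inE.
  move/rowP: cQ => /(_ (enum_rank_in vA' v)); rewrite !mxE coef_sum => cQ0.
  rewrite -[RHS]cQ0; apply: eq_bigr => j _.
  by rewrite coefZ mxE enum_rankK_in.
have := regular_even dl lF regl.
by rewrite card_half_whisker_odd.
Qed.

End Depth.

Theorem theorem3p12 (k : closedFieldType) (k_char0 : [pchar k] =i pred0)
    (n : nat) (G : sgraph) (G_card : #|G| = n) :
  graph_depth k (whisker G) (n - indep_num G)%N.
Proof.
have [A indA cardA] : {A : {set G} | independent A & indep_num G = #|A|}.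
  apply: eq_bigmax_cond; apply/card_gt0P; exists set0.
  by apply/independentP => u v; rewrite inE.
have maxind (S : {set G}) : independent S -> (#|S| <= #|A|)%N.
  by move=> indS; rewrite -cardA /indep_num; apply: leq_bigmax_cond.
have n_A : (n - indep_num G)%N = #|~: A| by rewrite cardA -G_card [RHS]cardsCs setCK.
split=> [|s /reg_seqP regs]; last first.
  rewrite n_A; apply: regular_seq_size regs => // S indS AS.
  by apply/esym/eqP; rewrite eqEcard AS maxind.
pose t (v : G) : k := (enum_rank v)%:R.
have t_inj : injective t.
  have char0 := (pcharf0P k).1 k_char0.
  have le_inj (a b : nat) : (a <= b)%N -> a%:R = b%:R :> k -> a = b.
    move=> ab /eqP; rewrite eq_sym -subr_eq0 -natrB // char0 subn_eq0 => ba.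
    by apply/eqP; rewrite eqn_leq ab.
  move=> u v uv; apply/enum_rank_inj/val_inj.
  by case/orP: (leq_total (enum_rank u) (enum_rank v)) => ?;
    [|apply/esym]; apply: le_inj.
exists (mkseq (moment_form t) (n - indep_num G)); last by rewrite size_mkseq.
apply/reg_seqP; apply: moment_seq_regular => // S indS.
by rewrite n_A -(cardsC A) addnC leq_add2r maxind.
Qed.
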